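(* There exists a countable class $\mathcal{C}$ of subsets of $\mathbb{N}$ whose Vapnik-Chervonenkis dimension is two (that is, the $\gamma$-dimension of $\{\mathbf{1}_C:C\in\mathcal{C}\}$ is two for all $0<\gamma<1$) such that the following holds: for any real-valued function $n(\varepsilon)$ that increases to $\infty$ as $\varepsilon\downarrow0$, there is a probability measure $\mu$ on $\mathbb{N}$ such that $N_{[]}(\mathcal{C},\varepsilon,\mu)\ge n(\varepsilon)$ for all $0<\varepsilon<1/3$. In particular, $\sup_\mu N_{[]}(\mathcal{C},\varepsilon,\mu)=\infty$ for all $0<\varepsilon<1/3$, where the supremum is over all probability measures $\mu$ on $\mathbb{N}$.
   Context: A family $\mathcal{F}$ of functions on a set $X$ $\gamma$-shatters a subset $X_0\subseteq X$ if there exist levels $\alpha<\beta$ with $\beta-\alpha\ge\gamma$ such that for every finite subset $\{x_1,\dots,x_n\}\subseteq X_0$ (distinct points) and every $F\subseteq\{1,\dots,n\}$ there exists $f\in\mathcal{F}$ with $f(x_j)<\alpha$ for $j\in F$ and $f(x_j)>\beta$ for $j\notin F$. The $\gamma$-dimension of $\mathcal{F}$ is the maximal cardinality of $\gamma$-shattered finite subsets of $X$. Given $\varepsilon>0$ and a probability measure $\mu$ on $\mathbb{N}$ (with the $\sigma$-field of all subsets), a pair of functions $f^-\le f^+$ (pointwise) with $\int(f^+-f^-)\,d\mu\le\varepsilon$ defines an $\varepsilon$-bracket in $L^1(\mu)$, $[f^-,f^+]:=\{f: f^-\le f\le f^+\text{ pointwise}\}$. $N_{[]}(\mathcal{C},\varepsilon,\mu)$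 is the cardinality of the smallest collection of $\varepsilon$-brackets in $L^1(\mu)$ covering the class of indicators $\{\mathbf{1}_C:C\in\mathcal{C}\}$. The function $n$ is finite-valued and nonincreasing in $\varepsilon$, with $n(\varepsilon)\to\infty$ as $\varepsilon\downarrow0$. *)

(* Defs.v *)
From HB Require Import structures.
From mathcomp Require Import all_boot all_order all_algebra.
From mathcomp Require Import all_classical all_reals all_analysis.
Set Implicit Arguments.
Unset Strict Implicit.
Unset Printing Implicit Defensive.
Import Order.TTheory GRing.Theory Num.Theory.
Import numFieldNormedType.Exports.
Local Open Scope classical_set_scope.
Local Open Scope ring_scope.

Definition shatters (R : realType) (X : Type) (F : set (X -> R)) (gamma : R)
    (X0 : set X) : Prop :=
  exists alpha beta : R,
    [/\ alpha < beta, gamma <= beta - alpha &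
      forall (n : nat) (x : 'I_n -> X),
        injective x -> (forall j, X0 (x j)) ->
        forall J : {set 'I_n}, exists2 f, F f &
          (forall j, j \in J -> f (x j) < alpha) /\
          (forall j, j \notin J -> beta < f (x j))].

(* Extended-real valued, so that it is +oo when finite shattered sets of
   arbitrarily large cardinality exist (and -oo when F is empty). *)
Definition gamma_dim (R : realType) (X : Type) (F : set (X -> R)) (gamma : R)
    : \bar R :=
  ereal_sup [set (k%:R)%:E | k in
    [set k : nat | exists2 X0 : set X, (X0 #= `I_k)%card & shatters F gamma X0]].

Definition indicators (R : realType) (T : Type) (C : set (set T))
    : set (T -> R) :=
  [set (\1_A : T -> R) | A in C].
Arguments indicators R {T} C.

Definition bracket (R : realType) (T : Type) (b : (T -> R) * (T -> R))
    : set (T -> R) :=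
  [set f | forall x, b.1 x <= f x <= b.2 x].

Definition is_bracket (R : realType) (d : measure_display)
    (T : measurableType d) (mu : probability T R) (eps : R)
    (b : (T -> R) * (T -> R)) : Prop :=
  [/\ mu.-integrable setT (EFin \o b.1),
      mu.-integrable setT (EFin \o b.2),
      forall x, b.1 x <= b.2 x &
      (\int[mu]_x (b.2 x - b.1 x)%:E <= eps%:E)%E].

(* The value is +oo when no finite collection of brackets covers the class. *)
Definition bracketing_number (R : realType) (d : measure_display)
    (T : measurableType d) (C : set (set T)) (eps : R) (mu : probability T R)
    : \bar R :=
  ereal_inf [set (k%:R)%:E | k in
    [set k : nat | exists B : set ((T -> R) * (T -> R)),
      [/\ (B #= `I_k)%card,
          (forall b, B b -> is_bracket mu eps b) &
          indicators R C `<=` \bigcup_(b in B) bracket b]]].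

(* Main.v *)
Require Import Defs.
From HB Require Import structures.
From mathcomp Require Import all_boot all_order all_algebra.
From mathcomp Require Import all_classical all_reals all_analysis.
From mathcomp Require Import zify ring lra.
Set Implicit Arguments.
Unset Strict Implicit.
Unset Printing Implicit Defensive.
Import Order.TTheory GRing.Theory Num.Theory.
Import numFieldNormedType.Exports.
Local Open Scope classical_set_scope.
Local Open Scope ring_scope.

(* The class consists of the non-vertical lines of the affine planes over all
   the prime fields F_p, laid out disjointly in nat.  Two distinct lines share at
   most one point, so no three points are shattered.  If k < p brackets cover
   the lines of the plane of order p, then by pigeonhole some bracket captures at
   least p of them; these cover at least p + (p - 1) + ... + 1 points, and at most
   one point lies on all of them, so the bracket has size at least 1/2 for the
   uniform measure of the plane.  The measure mu gives mass 2 / 3 ^ (j + 1) to the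
   uniform measure of a plane of order p_j >= n (1 / 3 ^ (j + 2)): level j takes
   care of 1 / 3 ^ (j + 2) <= eps < 1 / 3 ^ (j + 1), half of that mass, and the
   levels j >= 0 exhaust ]0, 1/3[. *)

(** * Counting unions of sets that pairwise share at most one point *)

(** Adding the sets one at a time, each new set loses at most one point to each earlier one; the
    losses 0 + 1 + ... + (s - 1) sum to the binomial term. *)
Lemma card_bigcup_linear (I T : finType) (F : I -> {set T}) (m : nat)
    (s : seq I) :
  uniq s -> (forall i, #|F i| = m) ->
  {in s &, forall i j, i != j -> (#|F i :&: F j| <= 1)%N} ->
  (size s * m <= #|(\bigcup_(i <- s) F i)%SET| + 'C(size s, 2))%N.
Proof.
move=> + cardF; elim: s => [|i s IH]/=; first by rewrite mul0n.
move=> /andP [ins us] lin; rewrite big_cons.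
have {}IH : (size s * m <= #|(\bigcup_(i <- s) F i)%SET| + 'C(size s, 2))%N.
  by apply: IH => // j k js ks; apply: lin; rewrite inE ?js ?ks orbT.
have cap : (#|F i :&: \bigcup_(j <- s) F j| <= size s)%N.
  have: {in s, forall j, (#|F i :&: F j| <= 1)%N}.
    move=> j js; apply: lin; rewrite ?inE ?eqxx ?js ?orbT//.
    by apply: contraNneq ins => ->.
  elim: (s) => [|j t IHt] lint; first by rewrite big_nil finset.setI0 cards0.
  rewrite big_cons finset.setIUr /= -add1n.
  apply: leq_trans (leq_card_setU _ _) _; rewrite leq_add ?lint ?inE ?eqxx//.
  by apply: IHt => k kt; apply: lint; rewrite inE kt orbT.
rewrite cardsU cardF binS bin1 mulSn.
(* The subtraction in [cardsU] is truncated; this bound makes it exact. *)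
have : (#|F i :&: \bigcup_(j <- s) F j| <= m)%N.
  by rewrite -(cardF i) subset_leq_card// finset.subsetIl.
lia.
Qed.

(** Just [m] of the sets already cover m ^ 2 - m (m - 1) / 2 points, and m ^ 2 + m >= m ^ 2 + 2. The
    summand 2 later pays for discarding one point. *)
Lemma card_bigcup_linear_ge (I T : finType) (F : I -> {set T}) (m : nat)
    (S : {set I}) :
  (1 < m)%N -> (m <= #|S|)%N -> (forall i, #|F i| = m) ->
  {in S &, forall i j, i != j -> (#|F i :&: F j| <= 1)%N} ->
  (m ^ 2 + 2 <= 2 * #|(\bigcup_(i in S) F i)%SET|)%N.
Proof.
move=> m1 mS cardF lin.
have us : uniq (take m (enum S)) by rewrite take_uniq// enum_uniq.
have sS : {subset take m (enum S) <= S} by move=> i /mem_take; rewrite mem_enum.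
have := @card_bigcup_linear _ _ F m _ us cardF
  (fun i j iS js => lin i j (sS i iS) (sS j js)).
rewrite size_takel -?cardE//.
have -> : #|(\bigcup_(i <- take m (enum S)) F i)%SET| =
    #|(\bigcup_(i in take m (enum S)) F i)%SET|.
  by rewrite big_uniq.
have : (#|(\bigcup_(i in take m (enum S)) F i)%SET| <= #|(\bigcup_(i in S) F i)%SET|)%N.
  apply/subset_leq_card/bigcupsP => i /sS iS; exact: finset.bigcup_sup.
have := mul_bin_diag m 1; rewrite bin1.
nia.
Qed.

Lemma card_fiber_pigeonhole (I K : finType) (g : I -> K) (m : nat) :
  (#|K| * m < #|I|)%N -> exists k, (m < #|[set i | g i == k]%SET|)%N.
Proof.
move=> KI; apply/existsP; apply: contraLR KI => /existsPn small.
rewrite -leqNgt -sum1_card (partition_big g predT)//= -sum_nat_const.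
apply: leq_sum => k _.
have := small k; rewrite -leqNgt; apply: leq_trans; rewrite -sum1_card.
by apply/eq_leq/eq_bigl => i; rewrite inE.
Qed.

(** * Uniform measures and their geometric mixture *)

Section uniform_measure.
Context d (T : measurableType d) (R : realType) (I : finType) (f : I -> T) (i0 : I).

(** [i0] serves as the default of [nth] and witnesses that [I] is nonempty, so that the total mass
    is 1. *)
Definition uniform_measure : set T -> \bar R :=
  mscale (#|I|%:R^-1%:nng) (msum (fun k => \d_(f (nth i0 (enum I) k))) #|I|).

HB.instance Definition _ := Measure.on uniform_measure.

Lemma uniform_measureE A :
  uniform_measure A = (#|I|%:R^-1 * #|[set i | f i \in A]%SET|%:R)%:E.
Proof.
rewrite /uniform_measure /mscale /msum /= EFinM; congr (_ * _)%E.
transitivity (\sum_(i : I) (\d_(f i) A : \bar R))%E.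
  by rewrite -big_enum (big_nth i0) -cardE big_mkord.
rewrite -sum1_card natr_sum -sumEFin [RHS]big_mkcond; apply: eq_bigr => i _.
by rewrite inE diracE; case: (f i \in A).
Qed.

Lemma uniform_measure_setT : uniform_measure setT = 1%E.
Proof.
rewrite uniform_measureE (_ : finset _ = [set: I]%SET); last first.
  by apply/setP => i; rewrite !inE; apply/mem_set.
by rewrite cardsT mulVf// pnatr_eq0 -lt0n; apply/card_gt0P; exists i0.
Qed.

HB.instance Definition _ :=
  Measure_isProbability.Build _ _ _ uniform_measure uniform_measure_setT.

End uniform_measure.


Section geometric_mixture.
Context d (T : measurableType d) (R : realType) (P : nat -> probability T R).

Definition geometric_weight (j : nat) : {nonneg R} := (2 / 3 ^+ j.+1)%:nng.

Definition geometric_mixture : set T -> \bar R :=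
  mseries (fun j => mscale (geometric_weight j) (P j)) 0.

HB.instance Definition _ := Measure.on geometric_mixture.

Lemma geometric_mixture_ge j A :
  ((2 / 3 ^+ j.+1)%:E * P j A <= geometric_mixture A)%E.
Proof.
pose u k : \bar R := mscale (geometric_weight k) (P k) A.
rewrite /geometric_mixture /mseries.
have := @nneseries_lim_ge R u predT 0 j.+1 (fun k _ _ => measure_ge0 _ _).
apply: le_trans; rewrite big_nat_recr//= [X in (_ <= _ + X)%E]/u.
by rewrite leeDr// sume_ge0// => k _; exact: measure_ge0.
Qed.

Lemma geometric_mixture_setT : geometric_mixture setT = 1%E.
Proof.
rewrite /geometric_mixture /mseries; apply/cvg_lim => //.
rewrite (_ : (fun n => _) = EFin \o series (geometric (2 / 3) 3^-1)); last first.
  apply/funext => n /=; rewrite /series/= -sumEFin; apply: eq_bigr => k _.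
  rewrite /mscale/= probability_setT mule1; congr EFin.
  by rewrite exprS invfM exprVn mulrA.
apply: cvg_EFin; first exact: nearW.
rewrite [X in _ --> X](_ : _ = (2 / 3) / (1 - 3^-1) :> R); last by field.
by apply: cvg_geometric_series; rewrite ger0_norm ?invr_ge0// invf_lt1// ltr1n.
Qed.

HB.instance Definition _ :=
  Measure_isProbability.Build _ _ _ geometric_mixture geometric_mixture_setT.

End geometric_mixture.

(** * Lines of affine planes, coded in [nat] *)

(* For p not prime, 'F_p is the prime field of the least prime factor of p (of
   order 2 when p < 2), so every p yields a genuine affine plane; the first
   component of the code keeps the planes disjoint. *)
Definition plane_point (p : nat) (z : 'F_p * 'F_p) : nat :=
  pickle (p, (z.1 : nat, z.2 : nat)).
Arguments plane_point : clear implicits.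

Definition plane_line (p : nat) (l : 'F_p * 'F_p) : {set 'F_p * 'F_p} :=
  [set z : 'F_p * 'F_p | z.2 == l.1 * z.1 + l.2]%SET.
Arguments plane_line : clear implicits.

(* Vertical lines are omitted: p ^ 2 lines with p points each suffice. *)
Definition line_class : set (set nat) :=
  \bigcup_p range (fun l => plane_point p @` [set` plane_line p l]).

Lemma plane_point_order p q z w : plane_point p z = plane_point q w -> p = q.
Proof. by move=> /(pcan_inj pickleK) []. Qed.

Lemma plane_point_inj p : injective (plane_point p).
Proof.
by move=> [x y] [x' y'] /(pcan_inj pickleK) [] /val_inj -> /val_inj ->.
Qed.

(** Two distinct points of a non-vertical line differ in abscissa; subtracting the line equations
    gives (a - a') (x - x') = 0 in a field. *)
Lemma plane_line_inj2 p l l' z w : z != w ->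
  z \in plane_line p l -> w \in plane_line p l ->
  z \in plane_line p l' -> w \in plane_line p l' -> l = l'.
Proof.
case: l l' z w => [a b] [a' b'] [x y] [x' y']; rewrite !inE/= => zw.
move=> /eqP yE /eqP y'E /eqP yE' /eqP y'E'.
have xx' : x - x' != 0.
  by apply: contra zw; rewrite subr_eq0 => /eqP xx'; rewrite yE y'E xx'.
have aa' : (a - a') * (x - x') = 0.
  have -> : (a - a') * (x - x') =
      (a * x + b) - (a * x' + b) - ((a' * x + b') - (a' * x' + b')) by ring.
  by rewrite -yE -y'E -yE' -y'E' subrr.
move: aa' => /eqP; rewrite mulf_eq0 (negPf xx') orbF subr_eq0 => /eqP aa'.
by move: yE'; rewrite yE aa' => /addrI ->.
Qed.

Lemma card_plane_line p l : prime p -> #|plane_line p l| = p.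
Proof.
move=> pp; rewrite -[RHS](card_Fp pp) -cardsT.
rewrite -(card_imset _ (f := fun x : 'F_p => (x, l.1 * x + l.2))); last first.
  by move=> x y [].
apply/eq_card => -[x y]; rewrite inE/=; apply/eqP/imsetP => [->|[x' _ [-> ->]]//].
by exists x.
Qed.

Lemma card_plane_lineI p l l' : l != l' ->
  (#|plane_line p l :&: plane_line p l'| <= 1)%N.
Proof.
move=> ll'; rewrite leqNgt; apply: contra ll' => /card_gt1P[z [w []]].
rewrite !finset.in_setI => /andP[zl zl'] /andP[wl wl'] zw.
apply/eqP; exact: (@plane_line_inj2 p _ _ z w).
Qed.

Lemma countable_line_class : countable line_class.
Proof.
apply: bigcup_countable => // p _; apply/finite_set_countable.
exact/finite_image/finite_finset.
Qed.

Lemma line_class_linear (A A' : set nat) (x y : nat) :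
  line_class A -> line_class A' -> x != y -> A x -> A y -> A' x -> A' y -> A = A'.
Proof.
move=> [p _ [l _ <-]] [q _ [l' _ <-]] xy.
move=> [z zl zx] [w wl wy] [z' z'l z'x] [w' w'l w'y].
have pq : p = q by apply: (@plane_point_order _ _ z z'); rewrite zx.
subst q.
have zz' : z = z' by apply/(@plane_point_inj p); rewrite zx.
have ww' : w = w' by apply/(@plane_point_inj p); rewrite wy.
subst z' w'; suff -> : l = l' by [].
have zw : z != w by apply: contraNneq xy => zw; rewrite -zx -wy zw.
exact: (@plane_line_inj2 p _ _ z w).
Qed.

(** * Shattering by indicators: the dimension is two *)

Section linear_class.
Variables (R : realType) (T : pointedType) (C : set (set T)).

Lemma shatters_indicators (X0 : set T) (gamma : R) : gamma < 1 ->
  (forall D, D `<=` X0 -> exists2 A, C A & A `&` X0 = D) ->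
  shatters (indicators R C) gamma X0.
Proof.
(* The levels are [e] and [1 - e]: e <= 1 / 3 separates them, e <= (1 - gamma) / 3 makes the gap at
   least [gamma]. The minimum with 1 covers negative [gamma]. *)
move=> g1 CX0; pose e := Num.min (1 - gamma) 1 / 3.
have eg : e <= (1 - gamma) / 3 by rewrite ler_pM2r ?invr_gt0// ge_min lexx.
have e1 : e <= 1 / 3 by rewrite ler_pM2r ?invr_gt0// ge_min lexx orbT.
have e0 : 0 < e by rewrite divr_gt0// lt_min subr_gt0 g1 ltr01.
exists e, (1 - e); split; [lra|lra|] => n x xinj xX0 J.
have [|A CA AX0] := CX0 (X0 `&` ~` (x @` [set` J])); first exact: subIsetl.
exists \1_A; first by exists A.
split=> j jJ; rewrite indicE.
  rewrite memNset// => Axj.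
  have : (X0 `&` ~` (x @` [set` J])) (x j) by rewrite -AX0.
  by move=> [_]; apply; exists j.
rewrite mem_set ?ltrBlDl ?ltrDr//.
have : (X0 `&` ~` (x @` [set` J])) (x j).
  by split => // -[i iJ /xinj ij]; move: jJ; rewrite -ij => /negP; apply.
by rewrite -AX0 => -[].
Qed.

Hypothesis C_linear : forall A A' x y,
  C A -> C A' -> x != y -> A x -> A y -> A' x -> A' y -> A = A'.

(** Out of three shattered points, some [A] contains all and some [B] exactly the first two; sharing
    two points, [A] and [B] coincide, which is absurd at the third. *)
Lemma shatters_indicators_le2 (X0 : set T) (gamma : R) (k : nat) :
  0 < gamma -> (X0 #= `I_k)%card -> shatters (indicators R C) gamma X0 ->
  (k <= 2)%N.
Proof.
move=> g0 X0k [a [b [ab _ sh]]]; rewrite leqNgt; apply/negP => k3.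
have [x xinj xX0] : exists2 x : 'I_3 -> T, injective x & forall j, X0 (x j).
  have : (`I_3 #<= X0)%card.
    by rewrite (card_le_eqr X0k) card_le_II.
  move=> /pcard_leP[f]; exists (fun i : 'I_3 => f i) => [i j fij|j].
    by apply/val_inj/(@inj _ _ `I_3 f); rewrite ?inE//=.
  exact: (@funS _ _ `I_3 X0 f j (ltn_ord j)).
have [_ [A CA <-] [_ hA]] := sh 3%N x xinj xX0 finset.set0.
have [_ [B CB <-] [hB2 hB]] := sh 3%N x xinj xX0 [set ord_max]%SET.
have {}hB2 := hB2 ord_max (set11 _).
have {hB} [hB0 hB1] : b < \1_B (x ord0) /\ b < \1_B (x (inord 1)).
  by split; apply: hB; rewrite inE -val_eqE/= ?inordK.
have ind01 (D : set T) y : \1_D y = 0 :> R \/ (\1_D y = 1 :> R /\ D y).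
  rewrite indicE; case: (boolP (y \in D)) => [|_]; [right|by left].
  by split=> //; apply/set_mem.
(* The indicator of [B] is below [a] at one point and above [b > a] at another, so it is 0 and 1
   there; hence a value above [b] means membership. *)
have b0 : 0 < b.
  by case: (ind01 B (x ord_max)) hB2 => [->|[->]];
    case: (ind01 B (x ord0)) hB0 => [->|[->]]; lra.
have hAx j : A (x j).
  have := hA j; rewrite finset.in_set0 => /(_ isT).
  by case: (ind01 A (x j)) => [->|[_ //]]; lra.
have Bx0 : B (x ord0) by case: (ind01 B (x ord0)) hB0 => [->|[_ //]]; lra.
have Bx1 : B (x (inord 1)).
  by case: (ind01 B (x (inord 1))) hB1 => [->|[_ //]]; lra.
have AB : A = B.
  apply: (C_linear CA CB _ (hAx ord0) (hAx (inord 1)) Bx0 Bx1).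
  by apply/eqP => /xinj /(congr1 val); rewrite /= inordK.
have := hAx ord_max; rewrite AB => Bx2.
move: hB2 hB0; rewrite !indicE !mem_set//=; lra.
Qed.

Lemma gamma_dim_indicators_linear (x y : T) (gamma : R) : x != y ->
  (forall D, D `<=` [set x; y] -> exists2 A, C A & A `&` [set x; y] = D) ->
  0 < gamma < 1 -> gamma_dim (indicators R C) gamma = 2%:E.
Proof.
move=> xy sh /andP[g0 g1]; apply/eqP; rewrite eq_le; apply/andP; split.
  apply: ge_ereal_sup => _ [k [X0 X0k X0sh] <-].
  by rewrite lee_fin ler_nat; exact: shatters_indicators_le2 X0sh.
apply: ereal_sup_ubound; exists 2%N => //; exists [set x; y]; last exact: shatters_indicators.
have -> : [set x; y] = (fun k => if k is 0%N then x else y) @` `I_2.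
  apply/seteqP; split=> [_ [->|->]|_ [[|k] _ <-]]; [| |by left|by right].
    by exists 0%N.
  by exists 1%N.
apply: inj_card_eq => -[|[|i]] [|[|j]]; rewrite !inE//= => _ _ xyE.
  by rewrite xyE eqxx in xy.
by rewrite xyE eqxx in xy.
Qed.

End linear_class.

Lemma plane_point_line p l z :
  (plane_point p @` [set` plane_line p l]) (plane_point p z) <-> z \in plane_line p l.
Proof. by split=> [[w wl /plane_point_inj <-]|zl]; [exact: wl|exists z]. Qed.

(** Over F_2 the line y = a x + b contains (0, 0) iff b = 0 and (1, 0) iff a + b = 0, so its four
    lines cut out all four subsets. *)
Lemma plane2_shattered (D : set nat) :
  let X0 := [set plane_point 2 (0, 0); plane_point 2 (1, 0)] in
  D `<=` X0 -> exists2 A, line_class A & A `&` X0 = D.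
Proof.
move=> X0 DX0; pose P := plane_point 2 (0, 0); pose Q := plane_point 2 (1, 0).
suff [l lP lQ] : exists2 l : 'F_2 * 'F_2,
    (D P <-> (0, 0) \in plane_line 2 l) & (D Q <-> (1, 0) \in plane_line 2 l).
  exists (plane_point 2 @` [set` plane_line 2 l]).
    by exists 2%N => //; exists l.
  apply/seteqP; split=> [n [nl nX0]|n Dn].
  - by case: nX0 nl => -> /plane_point_line; [move/lP|move/lQ].
  - split; last exact: DX0.
    by case: (DX0 _ Dn) (Dn) => -> ?; apply/plane_point_line; [exact/lP|exact/lQ].
have [dP|dP] := pselect (D P); have [dQ|dQ] := pselect (D Q).
- by exists (0, 0); split; rewrite ?inE.
- by exists (1, 0); split; rewrite ?inE.
- by exists (1, 1); split; rewrite ?inE.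
- by exists (0, 1); split; rewrite ?inE.
Qed.

(** * Lower bounds for bracketing numbers *)

Lemma plane_bracketing_number_ge (R : realType) (mu : probability nat R)
    (p : nat) (c eps : R) : prime p -> 0 <= c -> eps < c / 2 ->
  (forall A, (c%:E * uniform_measure R (plane_point p) (0, 0)%R A <= mu A)%E) ->
  (p%:R%:E <= bracketing_number line_class eps mu)%E.
Proof.
move=> pp c0 epsc muc; apply: le_ereal_inf_tmp => _ [k [B [Bk Bbr cov]] <-].
rewrite lee_fin ler_nat leqNgt; apply/negP => kp.
pose L l := plane_point p @` [set` plane_line p l].
have /choice[g gP] : forall l, exists b, B b /\ bracket b (\1_(L l) : nat -> R).
  move=> l; have [|b Bb bl] := cov (\1_(L l)); last by exists b.
  by exists (L l) => //; exists p => //; exists l.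
(* [h] numbers the brackets, so that the pigeonhole applies to a finite type: there are p ^ 2 lines
   and k p < p ^ 2. *)
have [h] : $|{injfun B >-> `I_k}| by apply/pcard_leP; rewrite (card_le_eql Bk) card_le_II.
have hk l : (h (g l) < k)%N by exact: (@funS _ _ B `I_k h _ (gP l).1).
pose idx l : 'I_k := Ordinal (hk l).
have [|i] := @card_fiber_pigeonhole _ _ idx p.
  by rewrite card_ord card_prod !card_Fp// ltn_pmul2r// prime_gt0.
set S := [set l | _]%SET => pS.
have [l0 [l1 [l0S l1S l01]]] : exists l0 l1, [/\ l0 \in S, l1 \in S & l0 != l1].
  by apply/card_gt1P; apply: leq_trans pS; rewrite ltnW// ltnS prime_gt1.
have gS l : l \in S -> g l = g l0.
  move=> lS; apply: (@inj _ _ B h); rewrite ?inE; [exact: (gP l).1|exact: (gP l0).1|].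
  by move: lS l0S; rewrite !inE => /eqP <- /eqP /(congr1 val).
(* A point of D lies on one of the lines captured by the bracket b and off
   another one, so the gap of b is at least 1 there. *)
pose D := (\bigcup_(l in S) plane_line p l :\: (plane_line p l0 :&: plane_line p l1))%SET.
have D_large : (p ^ 2 <= 2 * #|D|)%N.
  have := @card_bigcup_linear_ge _ _ (plane_line p) p S (prime_gt1 pp) (ltnW pS)
    (fun l => card_plane_line l pp) (fun l l' _ _ => @card_plane_lineI p l l').
  rewrite -(cardsID (plane_line p l0 :&: plane_line p l1)%SET).
  have := card_plane_lineI l01.
  have := subset_leq_card (finset.subsetIr
    (\bigcup_(l in S) plane_line p l) (plane_line p l0 :&: plane_line p l1))%SET.
  rewrite -/D; lia.
pose b := g l0.
have bD z : z \in D -> 1 <= b.2 (plane_point p z) - b.1 (plane_point p z).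
  rewrite finset.in_setD finset.in_setI negb_and => /andP[zl01 /finset.bigcupP[l lS zl]].
  have b1 : 1 <= b.2 (plane_point p z).
    have /andP[_] := (gP l).2 (plane_point p z); rewrite (gS _ lS) indicE mem_set//.
    by apply/plane_point_line.
  have b0 l' : l' \in S -> z \notin plane_line p l' -> b.1 (plane_point p z) <= 0.
    move=> lS' zl'; have /andP[+ _] := (gP l').2 (plane_point p z).
    rewrite (gS _ lS') indicE memNset//.
    by move=> /plane_point_line; apply/negP.
  suff : b.1 (plane_point p z) <= 0 by lra.
  by case/orP: zl01; [exact: b0 l0S|exact: b0 l1S].
have [_ _ b12 bint] := Bbr _ (gP l0).1.
pose E := plane_point p @` [set` D].
(* Markov's inequality: the gap of [b] dominates the indicator of [E]. *)
have muE : (mu E <= eps%:E)%E.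
  apply: le_trans bint; rewrite -(setTI E) setIC -integral_indic//.
  apply: ge0_le_integral => //= x _; rewrite lee_fin indicE.
  have [|_] := boolP (x \in E); last by rewrite subr_ge0.
  by move=> /set_mem[z zD <-]; exact: bD.
have : ((c / 2)%:E <= mu E)%E.
  apply: le_trans (muc E); rewrite uniform_measureE -EFinM lee_fin ler_wpM2l//.
  rewrite card_prod !card_Fp// mulrC ler_pdivlMr; last first.
    by rewrite ltr0n muln_gt0 prime_gt0.
  rewrite mulrC ler_pdivrMr// -natrM ler_nat mulnC.
  apply: leq_trans D_large _; rewrite leq_pmul2l//.
  by apply/subset_leq_card/fintype.subsetP => z zD; rewrite inE mem_set//; exists z.
by move=> /le_trans /(_ muE); rewrite lee_fin leNgt epsc.
Qed.

Lemma pow3_bracket (R : realType) (eps : R) : 0 < eps < 3^-1 ->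
  exists j, (3 ^+ j.+2)^-1 <= eps < (3 ^+ j.+1)^-1.
Proof.
move=> /andP[e0 e3].
have ex : exists m, (3 ^+ m)^-1 <= eps.
  exists (Num.bound eps^-1); rewrite -[leRHS]invrK lef_pV2 ?posrE ?invr_gt0// ?exprn_gt0//.
  apply/ltW/(lt_le_trans (archi_boundP _)); first by rewrite invr_ge0 ltW.
  by rewrite -natrX ler_nat ltnW// ltn_expl.
(* The least exponent is neither 0 nor 1 because eps < 1 / 3; minimality gives the upper bound. *)
case: (ex_minnP ex) => -[|[|j]] jeps minj.
- by move: jeps; rewrite expr0 invr1; lra.
- by move: jeps; rewrite expr1; lra.
exists j; rewrite jeps/= ltNge; apply/negP => /minj.
by rewrite ltnn.
Qed.

Lemma line_class_bracketing_number_ge (R : realType) (n : R -> R) :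
  (forall x y : R, 0 < x -> x <= y -> n y <= n x) ->
  exists mu : probability nat R, forall eps : R, 0 < eps < 3^-1 ->
    ((n eps)%:E <= bracketing_number line_class eps mu)%E.
Proof.
move=> n_noninc.
(* The order is chosen at the left end of level [j], where the nonincreasing [n] is largest on that
   level. *)
have /choice[p pP] : forall j, exists p, prime p /\ n (3 ^+ j.+2)^-1 <= p%:R.
  move=> j; have [p np pp] := prime_above (Num.bound `|n (3 ^+ j.+2)^-1|).
  exists p; split=> //; apply: (le_trans (ler_norm _)).
  by apply/ltW/(lt_le_trans (archi_boundP _)); rewrite ?normr_ge0 ?ler_nat// ltnW.
exists (geometric_mixture (fun j => uniform_measure R (plane_point (p j)) (0, 0))).
move=> eps /pow3_bracket[j /andP[jeps epsj]].
have [pj_prime npj] := pP j.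
have n_eps : ((n eps)%:E <= (p j)%:R%:E :> \bar R)%E.
  rewrite lee_fin (le_trans _ npj)// n_noninc// invr_gt0 exprn_gt0//.
apply: (le_trans n_eps); apply: (@plane_bracketing_number_ge _ _ _ (2 / 3 ^+ j.+1)) => //.
  by rewrite mulrAC mulfV// mul1r.
by move=> A; exact: geometric_mixture_ge.
Qed.

Theorem proposition1p7 (R : realType) :
  exists C : set (set nat),
    [/\ countable C,
        (forall gamma : R, 0 < gamma < 1 ->
           gamma_dim (indicators R C) gamma = 2%:E),
        (forall n : R -> R,
           (forall x y : R, 0 < x -> x <= y -> n y <= n x) ->
           n eps @[eps --> 0^'+] --> +oo ->
           exists mu : probability nat R,
             forall eps : R, 0 < eps < 3^-1 ->
               ((n eps)%:E <= bracketing_number C eps mu)%E) &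
        (forall eps : R, 0 < eps < 3^-1 ->
           ereal_sup [set bracketing_number C eps mu | mu in
             [set: probability nat R]] = +oo%E)].
Proof.
exists line_class; split.
- exact: countable_line_class.
- move=> gamma; apply: gamma_dim_indicators_linear plane2_shattered.
    exact: line_class_linear.
  by apply/eqP => /plane_point_inj.
- by move=> n n_noninc _; exact: line_class_bracketing_number_ge.
- move=> eps eps01; apply/eqyP => M _; apply: le_ereal_sup_tmp.
  (* The constant function [M] yields a measure with bracketing number at least [M], for every real
     [M]. *)
  have [mu muM] := @line_class_bracketing_number_ge R (fun=> M) (fun _ _ _ _ => lexx _).
  by exists (bracketing_number line_class eps mu); [exists mu|exact: muM].
Qed.
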